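(* Let $s\ge 1$ and consider any family $F=\{(x-a_i)^{e_i} : 1\le i\le s\}$ with $a_i\in\mathbb{R}$, $e_i\in\mathbb{N}$, the pairs $(a_i,e_i)$ pairwise distinct, satisfying the Pólya condition. Then $$\dim\langle F\rangle\ \ge\ \left\lfloor\frac{s}{2}\right\rfloor+1.$$
   Context: $\mathbb{N}$ contains $0$. The family $F$ satisfies the Pólya condition if, with $n_i=|\{j : e_j<i\}|$, one has $n_i\le i$ for all integers $i\ge 0$. $\langle F\rangle$ denotes the real vector space of polynomials spanned by $F$. *)

(* Defs.v *)
From mathcomp Require Import all_boot all_order all_algebra.
From mathcomp Require Import reals.

Set Implicit Arguments.
Unset Strict Implicit.
Unset Printing Implicit Defensive.

Import GRing.Theory.
Local Open Scope ring_scope.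

Definition shifted_power (R : realType) (a : R) (e : nat) : {poly R} :=
  ('X - a%:P) ^+ e.

Definition Polya_condition (s : nat) (e : 'I_s -> nat) : Prop :=
  forall i : nat, (#|[set j : 'I_s | (e j < i)%N]| <= i)%N.

(* {poly R} is infinite dimensional, hence not a vectType: the span is taken in
   the space of polynomials of size at most N, for the least N such that this
   space contains the whole family.  No polynomial is truncated by npolyp. *)
Definition family_size (R : realType) (s : nat) (f : 'I_s -> {poly R}) : nat :=
  (\max_(i < s) size (f i))%N.

Definition poly_span (R : realType) (s : nat) (f : 'I_s -> {poly R}) :
    {vspace {poly_(family_size f) R}} :=
  <<[seq npolyp (family_size f) (f i) | i : 'I_s]>>%VS.

Lemma poly_span_npolypK (R : realType) (s : nat) (f : 'I_s -> {poly R})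
  (i : 'I_s) : npolyp (family_size f) (f i) = f i :> {poly R}.
Proof. by apply: npolypK; apply: (leq_bigmax (F := fun i => size (f i))). Qed.

Lemma poly_spanP (R : realType) (s : nat) (f : 'I_s -> {poly R})
    (p : {poly_(family_size f) R}) :
  p \in poly_span f <->
  exists c : 'I_s -> R, (p : {poly R}) = \sum_(i < s) c i *: f i.
Proof.
have sumE (c : 'I_s -> R) :
    (\sum_(i < s) c i *: npolyp (family_size f) (f i) : {poly_(family_size f) R})
      = \sum_(i < s) c i *: f i :> {poly R}.
  rewrite (raddf_sum (val : {poly_(family_size f) R} -> {poly R})) /=.
  by apply: eq_bigr => i _; rewrite -[in RHS]poly_span_npolypK.
rewrite /poly_span /image_mem; split.
- rewrite span_def big_map big_enum /= => /memv_sumP[v vP ->].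
  have vE i : exists k, v i == k *: npolyp (family_size f) (f i).
    by have /vlineP[k ->] := vP i isT; exists k.
  exists (fun i => xchoose (vE i)); rewrite -sumE; congr (_ _).
  by apply: eq_bigr => i _; apply/eqP; apply: (xchooseP (vE i)).
- move=> [c pE]; have -> : p = \sum_(i < s) c i *: npolyp (family_size f) (f i).
    by apply: val_inj; rewrite /= pE sumE.
  apply: memv_suml => i _; apply/memvZ/memv_span/map_f.
  by rewrite mem_enum.
Qed.

(* Main.v *)
Require Import Defs.
From mathcomp Require Import all_boot all_order all_algebra.
From mathcomp Require Import reals.
From mathcomp Require Import polyrcf zify lra.

(** Sort the exponents increasingly. By the Polya condition the exponent of rank
    [i], counted from [0], is at least [i]. Keep the members of ranks
    [0, 1, 3, 5, ...]: they are [s %/ 2 + 1] in number, and at most [(t + 3) / 2]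
    of them have exponent at most [t], for every [t]. It remains to see that a
    family of real shifted powers which is sparse in this sense is linearly
    independent ([shifted_powers_free]).

    Let [\sum_i c_i (X - a_i)^(e_i) = 0] be a relation with nonzero
    coefficients and largest exponent [d]. Replacing each power by its
    truncation [(t - a_i)_+^(e_i)] gives a spline which is nonzero, but vanishes
    to the left of all the nodes [a_i], and also to the right of them by the
    relation. Count the sign changes of its successive derivatives. By Rolle's
    argument, differentiating a function that vanishes at both ends creates one
    more sign change, except that each jump may hide up to two of them; the
    [j]-th derivative jumps only at the nodes of exponent [j]
    ([zigzags_derived], [spline_mvt]). On the other hand the [d]-th derivative is
    a step function, whose sign changes are bounded by its number of jumps
    ([zigzags_step]). Comparing the two counts gives that the relation has at
    least [(d + 4) / 2] terms ([card_support_relation]), which contradicts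
    sparsity at [t = d]. *)

Set Implicit Arguments.
Unset Strict Implicit.
Unset Printing Implicit Defensive.

(** * Counting sign alternations *)

Section Alternation.
Import Order.TTheory GRing.Theory Num.Theory.
Local Open Scope ring_scope.
Variable R : rcfType.
Implicit Types (f : R -> R) (b : bool) (n : nat) (x y : R).

(** A lower bound on sign changes to the right of [x], with explicit witnesses:
    [n] points at which [f] is nonzero with alternating signs, the first sign
    being [(-1) ^+ b]. *)
Fixpoint alternates f b n x : Prop :=
  if n is m.+1 then
    exists y, [/\ x < y, 0 < (-1) ^+ b * f y & alternates f (~~ b) m y]
  else True.

(** The same count for the successive increments of [f], starting at [x]; this
    is the form to which the mean value theorem applies. *)
Fixpoint zigzags f b n x : Prop :=
  if n is m.+1 then
    exists y, [/\ x < y, 0 < (-1) ^+ b * (f y - f x) & zigzags f (~~ b) m y]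
  else True.

Lemma alternates_from_left f b n x y :
  x <= y -> alternates f b n y -> alternates f b n x.
Proof.
case: n => [//|n] le_xy [z [lt_yz fz altz]]; exists z; split=> //.
exact: le_lt_trans lt_yz.
Qed.

Lemma alternates_le f b m n x :
  (m <= n)%N -> alternates f b n x -> alternates f b m x.
Proof.
elim: m n b x => [//|m IH] [//|n] b x le_mn [y [lt_xy fy alty]].
by exists y; split=> //; apply: IH alty.
Qed.

(** Dropping the first point costs one alternation and flips the leading sign;
    used twice, it skips two points and keeps the leading sign. *)
Lemma alternates_behead f b n x :
  alternates f b n.+1 x -> alternates f (~~ b) n x.
Proof. by case=> y [/ltW lt_xy _]; apply: alternates_from_left. Qed.

(** Between consecutive points of opposite signs the increment has the sign of
    the later value, and a last increment is gained by returning to [0]. *)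
Lemma alternates_zigzags_tail f b n x :
  (forall y, exists2 z, y < z & f z = 0) ->
  0 < (-1) ^+ b * f x ->
  alternates f (~~ b) n x -> zigzags f (~~ b) n.+1 x.
Proof.
move=> f0; elim: n b x => [|n IH] b x fx.
  move=> _; have [z lt_xz fz0] := f0 x; exists z; split=> //.
  by rewrite signrN fz0; lra.
case=> y [lt_xy fy alty]; exists y; split=> //; last exact: IH.
by move: fy; rewrite signrN; lra.
Qed.

(** The gain behind Rolle's theorem: a function that vanishes at both ends has
    one more increment than it has values of alternating signs, since both the
    departure from [0] and the return to [0] count. *)
Lemma alternates_zigzags f b n x :
  (forall y, exists2 z, y < z & f z = 0) -> f x = 0 ->
  alternates f b n.+1 x -> zigzags f b n.+2 x.
Proof.
move=> f0 fx0 [y [lt_xy fy alty]]; exists y; split=> //.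
  by rewrite fx0 subr0.
exact: alternates_zigzags_tail.
Qed.

Section Jumps.
(* [f] may jump at the points [a i] with [J i]. *)
Variables (I : finType) (J : pred I) (a : I -> R).

Definition jumps_after x := #|[set i | J i && (x < a i)]|.

Lemma jumps_after_le x y : x <= y -> (jumps_after y <= jumps_after x)%N.
Proof.
move=> le_xy; apply/subset_leq_card/subsetP => i; rewrite !inE.
by case/andP=> -> /(le_lt_trans le_xy).
Qed.

Lemma jumps_after_lt x y :
  [exists i, [&& J i, x < a i & a i <= y]] ->
  (jumps_after y < jumps_after x)%N.
Proof.
case/existsP=> i /and3P[Ji lt_xa le_ay]; apply/proper_card/properP; split.
  apply/subsetP => k; rewrite !inE => /andP[->] /=.
  exact/lt_trans/(lt_le_trans lt_xa).
by exists i; rewrite !inE Ji ?lt_xa // ltNge le_ay.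
Qed.

(** An increment over an interval without jumps yields a point where the
    derivative [g] has the same sign. An increment over an interval containing
    a jump is lost, together with its neighbour so that the signs that remain
    still alternate: each jump costs at most two alternations. *)
Lemma zigzags_derived f g b n x :
  (forall b y z, y < z -> ~~ [exists i, [&& J i, y < a i & a i <= z]] ->
     0 < (-1) ^+ b * (f z - f y) ->
     exists t, [/\ y < t, t < z & 0 < (-1) ^+ b * g t]) ->
  zigzags f b n x -> alternates g b (n - (jumps_after x).*2) x.
Proof.
move=> mvt; elim: n b x => [|n IH] b x; first by rewrite sub0n.
case=> y [lt_xy fxy /IH alty].
have [jump|no_jump] := boolP [exists i, [&& J i, x < a i & a i <= y]].
  have lt_jumps := jumps_after_lt jump.
  apply: (alternates_from_left (y := y)); first exact: ltW.
  have [le_n|lt_n] := leqP (n - (jumps_after y).*2) 0.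
    by have -> : (n.+1 - (jumps_after x).*2 = 0)%N by lia.
  (* The interval from x to y is lost, and so is the next sign, that of ~~ b. *)
  rewrite -(negbK b); apply: alternates_behead.
  by apply: alternates_le alty; lia.
have [t [lt_xt lt_ty gt]] := mvt _ _ _ lt_xy no_jump fxy.
have := jumps_after_le (ltW lt_xy) => le_jumps.
apply: (alternates_le (n := (n - (jumps_after y).*2).+1)); first by lia.
exists t; split=> //; exact: alternates_from_left (ltW lt_ty) alty.
Qed.

(** A step function moves only at its jumps, so each increment uses up one. *)
Lemma zigzags_step f b n x :
  (forall y z, y < z -> ~~ [exists i, [&& J i, y < a i & a i <= z]] ->
     f z = f y) ->
  zigzags f b n x -> (n <= jumps_after x)%N.
Proof.
move=> stepf; elim: n b x => [//|n IH] b x [y [lt_xy fxy /IH le_n]].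
have [jump|no_jump] := boolP [exists i, [&& J i, x < a i & a i <= y]].
  by have := jumps_after_lt jump; lia.
by move: fxy; rewrite (stepf _ _ lt_xy no_jump) subrr mulr0 ltxx.
Qed.
End Jumps.
End Alternation.

(** * Derivatives of splines *)

Section Spline.
Import Order.TTheory GRing.Theory Num.Theory.
Local Open Scope ring_scope.
Variables (R : rcfType) (I : finType) (a : I -> R) (e : I -> nat) (c : I -> R).
Implicit Types (x y z : R) (j : nat) (i : I).

(** The polynomial with which the spline [\sum_i c i * (t - a i)_+ ^ (e i)]
    coincides on an interval starting at [x] that meets no further [a i]. *)
Definition piece x : {poly R} :=
  \sum_(i | a i <= x) c i *: ('X - (a i)%:P) ^+ e i.

(** The [j]-th derivative of that spline, taken piece by piece; at each [a i]
    the value is the limit from the right. *)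
Definition spline j x : R := (piece x)^`(j).[x].

(** The indices at whose node the [j]-th derivative may be discontinuous: a
    truncated power of exponent [e i] jumps when differentiated exactly [e i]
    times. *)
Definition knot j i := (c i != 0) && (e i == j).

Lemma derivn_XsubC_exp (b : R) n j :
  (('X - b%:P) ^+ n)^`(j) = ('X - b%:P) ^+ (n - j) *+ n ^_ j.
Proof.
elim: j => [|j IH]; first by rewrite subn0 ffactn0.
rewrite derivnS IH derivMn deriv_exp derivXsubC mul1r -mulrnA mulnC -ffactnSr.
by rewrite subnS.
Qed.

Lemma horner_derivn_piece j x y :
  (piece x)^`(j).[y] =
    \sum_(i | a i <= x) c i * ((y - a i) ^+ (e i - j) *+ e i ^_ j).
Proof.
rewrite /piece linear_sum /= horner_sum; apply: eq_bigr => i _.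
by rewrite derivnZ derivn_XsubC_exp hornerZ hornerMn horner_exp hornerXsubC.
Qed.

Lemma knot_term0 j i : ~~ knot j i -> c i * (0 ^+ (e i - j) *+ e i ^_ j) = 0.
Proof.
rewrite negb_and negbK => /orP[/eqP->|ne_ej]; first by rewrite mul0r.
rewrite expr0n subn_eq0; case: (ltngtP (e i) j) ne_ej => // lt_ej _.
  by rewrite ffact_small // mulr0n mulr0.
by rewrite mul0rn mulr0.
Qed.

Lemma eq_piece x y : x <= y -> (forall i, x < a i -> y < a i) ->
  piece y = piece x.
Proof.
move=> le_xy gap; apply: eq_bigl => i; apply/idP/idP; last first.
  by move/le_trans; apply.
by case: (leP (a i) x) => // /gap; rewrite ltNge => /negPf->.
Qed.

(** Continuity from the left at [y]: the terms entering at [y] have a vanishing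
    [j]-th derivative there, unless their exponent is exactly [j]. *)
Lemma spline_right_end j x y : x < y ->
  (forall i, x < a i -> y <= a i) ->
  ~~ [exists i, [&& knot j i, x < a i & a i <= y]] ->
  spline j y = (piece x)^`(j).[y].
Proof.
move=> lt_xy gap /existsPn no_knot.
rewrite /spline !horner_derivn_piece (bigID (fun i => a i <= x)) /=.
rewrite [X in _ + X]big1 ?addr0 => [|i /andP[le_ay]].
  apply: eq_bigl => i; rewrite andb_idl // => /le_trans; apply.
  exact: ltW.
rewrite -ltNge => lt_xa; have ay : a i = y.
  by apply/eqP; rewrite eq_le le_ay gap.
rewrite ay subrr knot_term0 //.
by have := no_knot i; rewrite lt_xa le_ay !andbT.
Qed.

(** A one-sided mean value inequality. The derivative may jump at nodes inside
    the interval, so the interval is cut at such a node and the half on which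
    the increment keeps its sign is retained, until a single polynomial piece
    is left. *)
Lemma spline_mvt j (b : bool) x y : x < y ->
  ~~ [exists i, [&& knot j i, x < a i & a i <= y]] ->
  0 < (-1) ^+ b * (spline j y - spline j x) ->
  exists t, [/\ x < t, t < y & 0 < (-1) ^+ b * spline j.+1 t].
Proof.
have [n] := ubnP #|[set i | x < a i < y]|.
elim: n x y => // n IH x y le_n lt_xy no_knot.
have [/existsP[i /andP[lt_xa lt_ay]]|no_node] :=
    boolP [exists i, x < a i < y]; last first.
  have gap i : x < a i -> y <= a i.
    by move=> lt_xa; have/existsPn/(_ i) := no_node; rewrite lt_xa -leNgt.
  rewrite (spline_right_end lt_xy) // /spline.
  have [t] := poly_mvt (piece x)^`(j) lt_xy.
  rewrite in_itv /= => /andP[lt_xt lt_ty] ->; rewrite mulrA pmulr_lgt0 ?subr_gt0 //.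
  move=> gt0; exists t; split=> //; rewrite (eq_piece (ltW lt_xt)) ?derivnS //.
  by move=> i /gap; apply: lt_le_trans.
move=> gt0.
have sub_card (u v : R) : x <= u -> v <= y -> (u == a i) || (v == a i) ->
    (#|[set k | (u < a k < v)%R]| < n)%N.
  move=> le_xu le_vy uv; rewrite -ltnS (leq_trans _ le_n) // ltnS.
  apply/proper_card/properP; split.
    apply/subsetP => k; rewrite !inE => /andP[lt_u lt_v].
    by rewrite (le_lt_trans le_xu) // (lt_le_trans lt_v).
  exists i; rewrite !inE ?lt_xa //.
  by case/orP: uv => /eqP->; rewrite ltxx ?andbF.
have sub_knot (u v : R) : x <= u -> v <= y ->
    ~~ [exists i, [&& knot j i, u < a i & a i <= v]].
  move=> le_xu le_vy; apply: contra no_knot => /existsP[k /and3P[kk lt_u le_v]].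
  by apply/existsP; exists k; rewrite kk (le_lt_trans le_xu) // (le_trans le_v).
have [gt0l|le0] := ltP 0 ((-1) ^+ b * (spline j (a i) - spline j x)).
  have [||t [lt_xt lt_ta gt0t]] := IH x (a i) _ lt_xa _ gt0l.
  - by apply: sub_card; rewrite ?eqxx ?orbT // ltW.
  - by apply: sub_knot; rewrite // ltW.
  by exists t; split=> //; apply: lt_trans lt_ay.
have [|||t [lt_xt lt_ta gt0t]] := IH (a i) y _ lt_ay.
- by apply: sub_card; rewrite ?eqxx // ltW.
- by apply: sub_knot; rewrite // ltW.
- by lra.
by exists t; split=> //; apply: lt_trans lt_xt.
Qed.

(** In the top degree only constants survive, multiplied by Heaviside steps. *)
Lemma spline_step d x y : (forall i, c i != 0 -> (e i <= d)%N) -> x < y ->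
  ~~ [exists i, [&& knot d i, x < a i & a i <= y]] ->
  spline d y = spline d x.
Proof.
move=> le_d lt_xy /existsPn no_knot.
have term z i : c i * ((z - a i) ^+ (e i - d) *+ e i ^_ d) =
    if knot d i then c i *+ d`! else 0.
  case: ifPn => [/andP[_ /eqP->]|].
    by rewrite subnn expr0 mulrnAr mulr1 ffactnn.
  rewrite negb_and negbK; have [->|c0] := eqVneq (c i) 0; first by rewrite mul0r.
  move=> /= ne_ed; rewrite ffact_small ?mulr0n ?mulr0 //.
  by rewrite ltn_neqAle ne_ed le_d.
rewrite /spline !horner_derivn_piece.
rewrite (eq_bigr _ (fun i _ => term y i)) (eq_bigr _ (fun i _ => term x i)).
rewrite -!big_mkcondr; apply: eq_bigl => i; apply/andP/andP=> -[le_a ki].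
  split=> //; rewrite leNgt; apply/negP => lt_xa.
  by have := no_knot i; rewrite ki lt_xa le_a.
by split=> //; apply: le_trans (ltW lt_xy).
Qed.

(** A nonzero polynomial has no root immediately to the right of [x], and the
    spline follows that polynomial there. *)
Lemma derivn_piece_neq0 j x :
  (piece x)^`(j) != 0 -> exists t, spline j t != 0.
Proof.
(* y is the first node after x; x + 1 serves when there is none. *)
move=> p_neq0; pose y := \big[Num.min/x + 1]_(i | x < a i) a i.
have lt_xy : x < y by apply: lt_bigmin => //; rewrite ltrDl.
have gap i : x < a i -> y <= a i by move=> lt_xa; apply: bigmin_le_cond.
pose r := next_root (piece x)^`(j) x y.
have lt_xr : x < r by apply: next_root_gt.
have le_ry : r <= y.
  have := next_root_in (piece x)^`(j) x y.
  by rewrite in_itv /= => /andP[_]; rewrite (max_idPl (ltW lt_xy)).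
pose t := (x + r) / 2.
have [lt_xt lt_tr] : x < t /\ t < r by rewrite /t; split; lra.
exists t; rewrite /spline (eq_piece (ltW lt_xt)) => [|i /gap]; last first.
  exact/lt_le_trans/(lt_le_trans lt_tr).
by apply: (next_noroot (a := x) (b := y)); rewrite in_itv /= lt_xt.
Qed.

Hypothesis inj_ae : injective (fun i => (a i, e i)).

(** At the leftmost node of top exponent [d], the [d]-th derivative of the
    current piece is the constant [c i * d!], because a node carries each
    exponent at most once. Hence no lower derivative vanishes either. *)
Lemma spline_neq0 d j : (j <= d)%N -> (forall i, c i != 0 -> (e i <= d)%N) ->
  (exists i, knot d i) -> exists x, spline j x != 0.
Proof.
move=> le_jd le_d [i1 knot1].
case: (Order.TotalTheory.arg_minP a knot1) => i0 knot0 min_a.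
apply: (@derivn_piece_neq0 j (a i0)); apply/eqP => p0.
have : (piece (a i0))^`(d).[a i0] = 0.
  by rewrite -(subnK le_jd) /derivn iterD -!/(derivn _ _) p0 linear0 horner0.
rewrite horner_derivn_piece (bigD1 i0) //= big1 ?addr0 => [|i /andP[le_a ne_i]].
  move: knot0 => /andP[c0 /eqP->] /eqP.
  rewrite subnn expr0 ffactnn mulf_eq0 (negPf c0) /= pnatr_eq0.
  by rewrite gtn_eqF ?fact_gt0.
have [ki|] := boolP (knot d i).
  case/eqP: ne_i; apply: inj_ae; congr (_, _).
    by apply/eqP; rewrite eq_le le_a min_a.
  by move: ki knot0 => /andP[_ /eqP->] /andP[_ /eqP->].
rewrite negb_and negbK => /orP[/eqP->|ne_ed]; first by rewrite mul0r.
have [->|ci] := eqVneq (c i) 0; first by rewrite mul0r.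
by rewrite ffact_small ?mulr0n ?mulr0 // ltn_neqAle ne_ed le_d.
Qed.

Hypothesis sum0 : \sum_i c i *: ('X - (a i)%:P) ^+ e i = 0.

(** To the right of all nodes the truncation is invisible and the spline is the
    vanishing linear combination itself. *)
Lemma spline_eventually0 j x : exists2 y, x < y & spline j y = 0.
Proof.
pose y := \big[Num.max/x + 1]_i a i; exists y.
  apply: (@lt_le_trans _ _ (x + 1)); first by rewrite ltrDl.
  exact: bigmax_ge_id.
rewrite /spline /piece (eq_bigl xpredT) ?sum0 ?linear0 ?horner0 // => i.
by rewrite /y (le_bigmax _ a).
Qed.

Lemma spline_eventually0_left :
  exists x0, forall j x, x <= x0 -> spline j x = 0.
Proof.
pose z : R := \big[Num.min/0]_i a i; exists (z - 1) => j x le_x.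
rewrite /spline /piece big1 ?linear0 ?horner0 // => i le_a.
have le_za : z <= a i by apply: bigmin_le_cond.
suff : z < z by rewrite ltxx.
by move: le_x le_a; lra.
Qed.

Lemma card_knots j x :
  (#|[set i | (c i != 0%R) && (e i < j)]| + jumps_after (knot j) a x
     <= #|[set i | (c i != 0%R) && (e i < j.+1)]|)%N.
Proof.
rewrite /jumps_after -cardsUI [X in (_ + X)%N](_ : _ = 0%N); last first.
  apply: eq_card0 => i; rewrite !inE; apply/negP => /andP[/andP[_ lt_e]].
  by case/andP=> /andP[_ /eqP e_ij]; rewrite e_ij ltnn in lt_e.
rewrite addn0; apply/subset_leq_card/subsetP => i; rewrite !inE ltnS.
case/orP=> [/andP[-> /ltnW]//|/andP[/andP[-> /eqP->] _]]; exact: leqnn.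
Qed.

(** A nontrivial relation needs about half as many terms as its degree. Write
    [n_j] for the number of alternations of the [j]-th derivative: [n_0 >= 1],
    and [n_(j+1) >= n_j + 1 - 2 k_j] where [k_j] is the number of terms of
    exponent [j]. Since the [d]-th derivative is a step function with [k_d]
    jumps which vanishes at both ends, [n_d + 1 <= k_d]; in particular
    [k_d >= 2] because [n_d >= 1]. Summing up,
    [d + 2 <= n_d + 1 + 2 \sum_(j < d) k_j <= 2 \sum_(j <= d) k_j - k_d]. *)
Lemma card_support_relation d : (forall i, c i != 0 -> (e i <= d)%N) ->
  (exists i, knot d i) -> (d + 4 <= #|[set i | c i != 0%R]|.*2)%N.
Proof.
move=> le_d knot_d.
have [x0 left0] := spline_eventually0_left.
pose m j := #|[set i | (c i != 0) && (e i < j)%N]|.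
have spl_alt j : (j <= d)%N ->
    exists b n, [/\ (0 < n)%N, (j.+1 <= n + (m j).*2)%N &
                 alternates (spline j) b n x0].
  have alt1 k : (k <= d)%N -> exists b, alternates (spline k) b 1 x0.
    move=> le_kd; have [x neq0] := spline_neq0 le_kd le_d knot_d.
    exists (spline k x < 0), x; split=> //.
      by rewrite ltNge; apply: contra neq0 => /left0->.
    have [lt0|gt0|eq0] := ltgtP (spline k x) 0; rewrite ?expr1 ?expr0; [lra|lra|].
    by rewrite eq0 eqxx in neq0.
  elim: j => [|j IH] le_jd.
    by have [b altb] := alt1 0 isT; exists b, 1; split.
  have [b [[|n] [n_gt0 le_n altn]]] := IH (ltnW le_jd); first by [].
  have zig := alternates_zigzags (spline_eventually0 j) (left0 _ _ (lexx _)) altn.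
  have := zigzags_derived (J := knot j) (a := a) (@spline_mvt j) zig.
  set k := jumps_after _ _ _ => alt.
  have le_k : (m j + k <= m j.+1)%N by apply: card_knots.
  (* If the count drops to 0, the derivative being nonzero restores it to 1. *)
  have [lt_n|le_n'] := leqP 1 (n.+2 - k.*2).
    by exists b, (n.+2 - k.*2)%N; split=> //; lia.
  have [b' alt'] := alt1 _ le_jd; exists b', 1; split=> //; lia.
have [b [[|n] [n_gt0 le_n altn]]] := spl_alt d (leqnn d); first by [].
have zig := alternates_zigzags (spline_eventually0 d) (left0 _ _ (lexx _)) altn.
have := zigzags_step (J := knot d) (a := a) (fun y z => @spline_step d y z le_d) zig.
set k := jumps_after _ _ _ => le_k.
have le_k' : (m d + k <= m d.+1)%N by apply: card_knots.
have le_m : (m d.+1 <= #|[set i | c i != 0%R]|)%N.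
  by apply/subset_leq_card/subsetP => i; rewrite !inE => /andP[].
by lia.
Qed.

End Spline.

(** * Independent subfamilies *)

Section Independence.
Import Order.TTheory GRing.Theory Num.Theory.
Local Open Scope ring_scope.

(** The support of a relation whose largest exponent is [d] would have both at
    least [(d + 4) / 2] and at most [(d + 3) / 2] elements. *)
Lemma shifted_powers_free (R : rcfType) (I : finType) (a : I -> R)
    (e : I -> nat) (c : I -> R) :
  injective (fun i => (a i, e i)) ->
  (forall t, #|[set i | (e i <= t)%N]|.*2 <= t + 3)%N ->
  \sum_i c i *: ('X - (a i)%:P) ^+ e i = 0 -> forall i, c i = 0.
Proof.
move=> inj_ae sparse sum0 i0; apply/eqP/negPn/negP => c0.
case: (arg_maxnP e (P := fun i => c i != 0) c0) => i ci max_e.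
have knot_i : knot e c (e i) i by rewrite /knot ci eqxx.
have supp := card_support_relation inj_ae sum0 max_e (ex_intro _ i knot_i).
have sub : (#|[set k | c k != 0%R]| <= #|[set k | (e k <= e i)%N]|)%N.
  by apply/subset_leq_card/subsetP => k; rewrite !inE; apply: max_e.
by have := sparse (e i); lia.
Qed.

(** Listing the exponents in increasing order, the entry of rank [i] and the [i]
    entries before it all lie below [e (sigma i) + 1], which the condition
    forces to be at least [i + 1]. *)
Lemma Polya_sorted (s : nat) (e : 'I_s -> nat) :
  (forall t, #|[set j : 'I_s | (e j < t)%N]| <= t)%N ->
  exists2 sigma : 'I_s -> 'I_s, injective sigma &
    forall i : 'I_s, (i <= e (sigma i))%N.
Proof.
move=> polya; pose r := sort (relpre e leq) (enum 'I_s).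
have size_r : size r = s by rewrite size_sort size_enum_ord.
have sorted_r : sorted (relpre e leq) r by apply: sort_sorted => i j; apply: leq_total.
have uniq_r : uniq r by rewrite sort_uniq enum_uniq.
(* The default value is never reached; any element of 'I_s would do. *)
pose sigma (i : 'I_s) := nth i r i.
have sigma_inj : injective sigma.
  move=> i j; rewrite /sigma (set_nth_default i j) ?size_r // => /eqP.
  by rewrite nth_uniq ?size_r // => /eqP/val_inj.
exists sigma => // i; rewrite -ltnS; apply: leq_trans (polya _).
have lt_is : (i.+1 <= s)%N := ltn_ord i.
have widen_inj : injective (sigma \o widen_ord lt_is).
  by move=> k l /sigma_inj/(congr1 val) kl; apply: val_inj.
rewrite -[i.+1]card_ord -(card_imset _ widen_inj).
apply/subset_leq_card/subsetP => _ /imsetP[k _ ->]; rewrite inE ltnS /=.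
rewrite /sigma (set_nth_default i (widen_ord lt_is k)) ?size_r //.
apply: (@sorted_leq_nth _ (relpre e leq) _ _ i r sorted_r) => //=.
- by move=> x y z; apply: leq_trans.
- by move=> x; apply: leqnn.
- by rewrite inE size_r (leq_trans (ltn_ord k)).
- by rewrite inE size_r.
- by rewrite -ltnS ltn_ord.
Qed.

Lemma card_ord_lt_le m n : (#|[set k : 'I_m | (k < n)%N]| <= n)%N.
Proof.
rewrite cardE -(size_map val) -[X in (_ <= X)%N](size_iota 0).
apply: uniq_leq_size; first by rewrite map_inj_uniq ?enum_uniq //; apply: val_inj.
by move=> _ /mapP[k k_in ->]; move: k_in; rewrite mem_enum inE mem_iota.
Qed.

Lemma dim_poly_span_ge (R : realType) (s m : nat) (f : 'I_s -> {poly R})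
    (tau : 'I_m -> 'I_s) :
  (forall c : 'I_m -> R, \sum_i c i *: f (tau i) = 0 -> forall i, c i = 0) ->
  (m <= \dim (poly_span f))%N.
Proof.
move=> indep; pose X := [tuple npolyp (family_size f) (f (tau i)) | i < m].
have free_X : free X.
  apply/freeP => c sum0; apply: indep.
  move/(congr1 val): sum0; rewrite (raddf_sum val) /= => sum0.
  rewrite -[RHS]sum0; apply: eq_bigr => i _.
  by rewrite (nth_map i) ?size_enum_ord // nth_ord_enum poly_span_npolypK.
rewrite -[m](size_tuple X) -(eqP free_X); apply/dimvS/sub_span => p.
by case/mapP=> i _ ->; apply/map_f; rewrite mem_enum.
Qed.

End Independence.

Theorem proposition4p4 (R : realType) (s : nat) (a : 'I_s -> R)
    (e : 'I_s -> nat) :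
  (1 <= s)%N ->
  injective (fun i : 'I_s => (a i, e i)) ->
  Polya_condition e ->
  (s %/ 2 + 1 <= \dim (poly_span (fun i : 'I_s => shifted_power (a i) (e i))))%N.
Proof.
move=> s_gt0 inj_ae /Polya_sorted[sigma sigma_inj le_e].
(* Ranks 0, 1, 3, 5, ...: [k.*2.-1] is truncated at [k = 0]. *)
have lt_s (k : 'I_(s %/ 2 + 1)) : (k.*2.-1 < s)%N by have := ltn_ord k; lia.
pose tau k := sigma (Ordinal (lt_s k)).
have tau_inj : injective tau.
  by move=> k l /sigma_inj/(congr1 val) /= kl; apply: val_inj => /=; lia.
apply: (dim_poly_span_ge (tau := tau)) => c.
apply: shifted_powers_free => [k l /inj_ae/tau_inj//|t].
(* The [k]-th exponent is at least [2 * k - 1]. *)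
have sub : (#|[set k | (e (tau k) <= t)%N]| <=
            #|[set k : 'I_(s %/ 2 + 1) | (k < (t + 3) %/ 2)%N]|)%N.
  apply/subset_leq_card/subsetP => k; rewrite !inE.
  by have := le_e (Ordinal (lt_s k)); rewrite -/(tau k) /=; lia.
by have := card_ord_lt_le (s %/ 2 + 1) ((t + 3) %/ 2); lia.
Qed.
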